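(* For each complete Boolean algebra $\mathbb{B}$ the following conditions are equivalent: (a) $\mathbb{B}$ is not $(\omega,2)$-distributive; (b) White has a winning strategy in the game $\mathcal{G}_1$ on $\mathbb{B}$; (c) White has a winning strategy in the game $\mathcal{G}_2$ on $\mathbb{B}$.
   Context: Let $\mathbb{B}$ be a complete Boolean algebra, $\mathbb{B}^+=\mathbb{B}\setminus\{0\}$, and for $p\in\mathbb{B}^+$ let $(0,p)_{\mathbb{B}}=\{b\in\mathbb{B}:0<b<p\}$. The games $\mathcal{G}_1,\mathcal{G}_2$ are played by two players, White and Black, on $\mathbb{B}$ in $\omega$-many moves. At the beginning White chooses $p\in\mathbb{B}^+$. In the $n$-th move ($n\in\omega$) White chooses $p_n\in(0,p)_{\mathbb{B}}$ and Black responds by choosing $i_n\in\{0,1\}$. Put $p_n^0=p_n$ and $p_n^1=p\setminus p_n$. White wins the play $\langle p,p_0,i_0,p_1,i_1,\dots\rangle$ in the game $\mathcal{G}_1$ (Jech's cut-and-choose game $\mathcal{G}_{\rm c\&c}$) iff $\bigwedge_{n\in\omega}p_n^{i_n}=0$; in the game $\mathcal{G}_2$ iff $\bigvee_{k\in\omega}\bigwedge_{n\ge k}p_n^{i_n}=0$. Otherwise Black wins. A winning strategy for a player is a function which, on the basis of the previous moves of both players, provides moves (obeying the rules) for that player such that the player always wins. $\mathbb{B}$ is $(\omega,2)$-distributive iff $\bigwedge_{n\in\omega}\bigvee_{j\in 2}b_{n,j}=\bigvee_{f:\omega\to 2}\bigwedge_{n\in\omega}b_{n,f(n)}$ for every family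 $\langle b_{n,j}: n\in\omega, j\in 2\rangle$ in $\mathbb{B}$ (equivalently, forcing by $\mathbb{B}$ adds no new subsets of $\omega$). *)

(* Defs.v *)
From HB Require Import structures.
From mathcomp Require Import all_boot all_order.
From mathcomp Require Import boolp classical_sets.

Set Implicit Arguments.
Unset Strict Implicit.
Unset Printing Implicit Defensive.

Import Order.Theory.
Local Open Scope classical_set_scope.
Local Open Scope order_scope.

(* [ctbDistrLatticeType] is the type of Boolean algebras; it allows the
   degenerate algebra with \bot = \top. *)
Definition complete_boolean_algebra d (B : ctbDistrLatticeType d) : Prop :=
  forall A : set B, supremums A !=set0 /\ infimums A !=set0.

(* The default values are those of the empty join and of the empty meet, so
   these are the join and the meet of every subset of a complete algebra. *)
Definition bigsup d (B : ctbDistrLatticeType d) (A : set B) : B :=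
  supremum \bot A.

Definition biginf d (B : ctbDistrLatticeType d) (A : set B) : B :=
  infimum \top A.

Definition omega2_distributive d (B : ctbDistrLatticeType d) : Prop :=
  forall b : nat -> bool -> B,
    biginf (range (fun n => \join_(j : bool) b n j)) =
    bigsup (range (fun f : nat -> bool => biginf (range (fun n => b n (f n))))).

Section Games.
Variables (d : Order.disp_t) (B : ctbDistrLatticeType d).

(* The play p, p_0, i_0, p_1, i_1, ... *)
Record play := Play {
  start : B;
  cut : nat -> B;
  response : nat -> bool
}.

(* p_n^{i_n} *)
Definition part (P : play) (n : nat) : B :=
  if response P n then start P `\` cut P n else cut P n.

Definition White_obeys_rules (P : play) : Prop :=
  \bot < start P /\ forall n, \bot < cut P n < start P.

Definition G1_White_wins (P : play) : Prop :=
  biginf (range (part P)) = \bot.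

Definition G2_White_wins (P : play) : Prop :=
  bigsup (range (fun k => biginf [set part P n | n in [set n | (k <= n)%N]]))
  = \bot.

(* [next p [:: (p_0, i_0); ...; (p_(n-1), i_(n-1))]] is White's choice p_n. *)
Record White_strategy := WhiteStrategy {
  opening : B;
  next : B -> seq (B * bool) -> B
}.

Definition history (P : play) (n : nat) : seq (B * bool) :=
  [seq (cut P k, response P k) | k <- iota 0 n].

Definition follows (s : White_strategy) (P : play) : Prop :=
  start P = opening s /\ forall n, cut P n = next s (start P) (history P n).

(* Black's moves are unrestricted, so every finite position reachable under s
   extends to a play following s: the rules are required at all of them. *)
Definition White_winning_strategy (wins : play -> Prop) (s : White_strategy) :
    Prop :=
  forall P, follows s P -> White_obeys_rules P /\ wins P.

Definition White_has_winning_strategy (wins : play -> Prop) : Prop :=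
  exists s, White_winning_strategy wins s.

End Games.

(* Main.v *)
Require Import Defs.
From mathcomp Require Import all_boot all_order.
From mathcomp Require Import boolp classical_sets.

(** The implications proved are (a) => (c) => (b) => (a).

    (a) => (c).  Seen from a generic extension, the failure of distributivity
    gives a condition [p] and names for truth values [x n], encoded by
    [p <= b n false `|` b n true], such that [p] forces the sequence [x] not to
    belong to the ground model: no nonzero [q <= p] lies below all the
    [b n (f n)], for any [f].  White opens with [p] and, at move [n], asks
    Black for [x n] by cutting [p] with [b n false].  A nonzero condition below
    a tail of Black's choices would decide all but finitely many of the [x n],
    and a smaller one would also decide the remaining ones, which is impossible
    ([undecided_tail]).  So White even wins the harder game G2, and does so
    without looking at Black's answers.  A question whose answer [p] already
    decides is not a legal cut; White replaces it by a fixed legal cut, which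
    loses nothing as [p] itself answers that question
    ([nondistributive_White_wins_G2]).

    (c) => (b).  The meet of all the parts is one of the elements joined in G2.

    (b) => (a).  Fix a strategy of White with opening [p].  Its positions are
    indexed by the finite sequences of Black's answers, which are countable, and
    [p] is split in two at each of them.  Distributivity provides one choice of
    a side at every position and a nonzero [q] below all the chosen sides.
    Black then wins by answering according to this choice
    ([White_wins_G1_nondistributive]). *)

Set Implicit Arguments.
Unset Strict Implicit.
Unset Printing Implicit Defensive.

Import Order.Theory.
Local Open Scope order_scope.

(** * Joins and meets in a complete Boolean algebra *)

Section CompleteBooleanAlgebra.
Context (d : Order.disp_t) (B : ctbDistrLatticeType d).
Hypothesis B_complete : complete_boolean_algebra B.

Lemma bigsup_supremums (A : set B) : supremums A (bigsup A).
Proof.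
rewrite /bigsup /supremum; case: eqP => [->|_].
  by split=> [x [] | y _]; exact: le0x.
by apply: xgetPex; have [] := B_complete A.
Qed.

Lemma biginf_infimums (A : set B) : infimums A (biginf A).
Proof.
rewrite /biginf /infimum; case: eqP => [->|_].
  by split=> [x [] | y _]; exact: lex1.
by apply: xgetPex; have [] := B_complete A.
Qed.

Lemma bigsup_le (A : set B) (u : B) :
  bigsup A <= u <-> forall a, A a -> a <= u.
Proof.
have [ubA lubA] := bigsup_supremums A.
by split=> [leAu a /ubA/le_trans | /lubA]; first exact.
Qed.

Lemma le_biginf (A : set B) (u : B) :
  u <= biginf A <-> forall a, A a -> u <= a.
Proof.
have [lbA glbA] := biginf_infimums A.
by split=> [leuA a /lbA | /glbA //]; exact: le_trans.
Qed.

Lemma bigsup_ge (A : set B) (a : B) : A a -> a <= bigsup A.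
Proof. exact: (bigsup_supremums A).1. Qed.

Lemma biginf_le (A : set B) (a : B) : A a -> biginf A <= a.
Proof. exact: (biginf_infimums A).1. Qed.

Lemma le_biginf_range T (F : T -> B) (u : B) :
  u <= biginf (range F) <-> forall t, u <= F t.
Proof.
split=> [/le_biginf le_u t | le_u]; first by apply: le_u; exists t.
by apply/le_biginf => _ [t _ <-].
Qed.

Lemma bigjoin_bool (F : bool -> B) :
  \join_(j : bool) F j = F false `|` F true.
Proof. by rewrite big_bool joinC. Qed.

(** The forcing form of distributivity, where [b n] is read as a name for a
    truth value.  The two sides of the distributive law differ exactly when some
    nonzero [p] lies below the first and is disjoint from the second, that is,
    when [p] forces the sequence of these truth values to be new. *)
Lemma omega2_distributiveP :
  omega2_distributive B <->
  forall (b : nat -> bool -> B) (p : B), \bot < p ->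
    (forall n, p <= b n false `|` b n true) ->
  exists f q, \bot < q <= p /\ forall n, q <= b n (f n).
Proof.
split=> [distr b p p_gt0 le_pb | decide b].
  (* Distributivity is applied below [p], so that the meet found lies there. *)
  pose c n j := p `&` b n j.
  have [//|noDec] := pselect (exists f q,
    \bot < q <= p /\ forall n, q <= b n (f n)).
  suff: p <= \bot by rewrite lex0 => /eqP p0; rewrite p0 ltxx in p_gt0.
  have: p <= biginf (range (fun n => \join_(j : bool) c n j)).
    by apply/le_biginf_range => n; rewrite bigjoin_bool -meetUr lexI lexx le_pb.
  rewrite distr => /le_trans; apply; apply/bigsup_le => _ [f _ <-].
  rewrite lex0; apply: contrapT => /negP neq0; apply: noDec.
  have /le_biginf_range le_c := lexx (biginf (range (fun n => c n (f n)))).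
  exists f, (biginf (range (fun n => c n (f n)))); split.
    by rewrite lt0x neq0 (le_trans (le_c 0%N) (leIl _ _)).
  by move=> n; exact: le_trans (le_c n) (leIr _ _).
apply/eqP; rewrite eq_le; apply/andP; split; last first.
  apply/bigsup_le => _ [f _ <-]; apply/le_biginf_range => n.
  apply: (@le_trans _ _ (b n (f n))); first by apply: biginf_le; exists n.
  exact: joins_sup.
set u := biginf _; set v := bigsup _.
rewrite -diff_eq0; apply: contrapT => /negP uv_neq0.
have [|n|f [q [/andP[q_gt0 le_q] le_qb]]] := decide b (u `\` v).
- by rewrite lt0x.
- apply: le_trans (leBx _ _) _; rewrite -bigjoin_bool.
  by apply: biginf_le; exists n.
have: q <= v.
  by apply: le_trans (bigsup_ge _); last exists f => //; apply/le_biginf_range.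
move: le_q; rewrite leBRL => /andP[_ /eqP qv0] /meet_idPl.
by rewrite qv0 => q0; rewrite -q0 ltxx in q_gt0.
Qed.

(** * From non-distributivity to a strategy in G2 *)

(** Finitely many truth values can be decided one after the other, by meeting
    [q] with one of the two alternatives. *)
Lemma undecided_tail (b : nat -> bool -> B) (p : B) :
    (forall n, p <= b n false `|` b n true) ->
    (forall f q, \bot < q <= p -> ~ forall n, q <= b n (f n)) ->
  forall k f q, \bot < q <= p -> ~ forall n, (k <= n)%N -> q <= b n (f n).
Proof.
move=> le_pb undec; elim=> [|k IHk] f q q_gt0p le_qb.
  by apply: (undec f q) => // n; exact: le_qb.
have /andP[q_gt0 le_qp] := q_gt0p.
have [j qj_neq0] : exists j, q `&` b k j != \bot.
  have: q `&` (b k false `|` b k true) != \bot.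
    by rewrite (meet_idPl (le_trans le_qp (le_pb k))) -lt0x.
  by rewrite meetUr join_eq0 negb_and => /orP[]; [exists false | exists true].
apply: (IHk (fun n => if n == k then j else f n) (q `&` b k j)).
  by rewrite lt0x qj_neq0 leIxl.
move=> n; rewrite leq_eqVlt eq_sym; case: eqP => [-> _|_ lt_kn].
  exact: leIr.
exact: leIxl (le_qb n lt_kn).
Qed.

Lemma nondistributive_White_wins_G2 :
  ~ omega2_distributive B -> White_has_winning_strategy (@G2_White_wins d B).
Proof.
move=> /omega2_distributiveP /existsNP[b /existsNP[p]].
move=> /not_implyP[p_gt0 /not_implyP[le_pb noDec]].
have undec f q : \bot < q <= p -> ~ forall n, q <= b n (f n).
  by move=> qp le_qb; apply: noDec; exists f, q.
pose legal a := \bot < a < p.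
have decided n : ~~ legal (p `&` b n false) -> exists j, p <= b n j.
  rewrite /legal lt0x lt_neqAle leIl andbT negb_and !negbK => /orP[] /eqP pb.
    exists true; have := le_pb n; rewrite joinC => le_p.
    by rewrite -(disjoint_lexUl _ pb).
  by exists false; rewrite -pb leIr.
(* If [p] decided every question, it would decide the whole sequence. *)
have [m legal_m] : exists m, legal (p `&` b m false).
  apply: contrapT => noLegal.
  have /choice[f le_f] n : exists j, p <= b n j.
    by apply: decided; apply/negP => legal_n; apply: noLegal; exists n.
  by apply: (undec f p) => //; rewrite p_gt0 lexx.
pose c n := let a := p `&` b n false in if legal a then a else p `&` b m false.
exists (WhiteStrategy p (fun _ h => c (size h))) => P [startP cutP].
have {}cutP n : cut P n = c n.
  by rewrite cutP /= /history size_map size_iota.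
split.
  rewrite /White_obeys_rules startP; split=> // n.
  by rewrite cutP /c /=; case: ifP.
apply/eqP; rewrite -lex0; apply/bigsup_le => _ [k _ <-].
set q := biginf _; rewrite lex0; apply: contrapT => /negP.
rewrite -lt0x => q_gt0.
have le_q n : (k <= n)%N -> q <= part P n.
  by move=> le_kn; apply: biginf_le; exists n.
have le_qp : q <= p.
  apply: le_trans (le_q k (leqnn k)) _.
  rewrite /part startP cutP /c /=; case: response; first exact: leBx.
  by case: ifP => _; exact: leIl.
(* Black's answer counts only for the questions that were really asked. *)
have /choice[f le_f] n : exists j, (k <= n)%N -> q <= b n j.
  have [legal_n|/decided[j le_pj]] := boolP (legal (p `&` b n false));
    last by exists j => _; exact: le_trans le_qp le_pj.
  exists (response P n) => /le_q /le_trans; apply.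
  rewrite /part startP cutP /c /= legal_n; case: response; last exact: leIr.
  rewrite diffxI diffxx join0x leBLR; exact: le_pb.
by apply: (undecided_tail le_pb undec (k := k) (f := f) (q := q));
  rewrite ?q_gt0.
Qed.

Lemma G2_White_wins_G1 (P : play B) : G2_White_wins P -> G1_White_wins P.
Proof.
move=> win2; apply/eqP; rewrite -lex0 -win2.
apply: le_trans (bigsup_ge _); last by exists 0%N.
by apply/le_biginf => _ [n _ <-]; apply: biginf_le; exists n.
Qed.

(** * Black's counterplay in G1 on a distributive algebra *)

(** Along [s], Black's answers alone determine the position; indexing by them
    makes the tree of positions countable, whatever the size of [B]. *)
Definition position (s : White_strategy B) (phi : seq bool) : seq (B * bool) :=
  foldl (fun h i => rcons h (Defs.next s (opening s) h, i)) [::] phi.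

Definition cut_at (s : White_strategy B) (phi : seq bool) : B :=
  Defs.next s (opening s) (position s phi).

Fixpoint answers (g : seq bool -> bool) (n : nat) : seq bool :=
  if n is k.+1 then rcons (answers g k) (g (answers g k)) else [::].

Definition counterplay (s : White_strategy B) (g : seq bool -> bool) : play B :=
  Play (opening s) (fun n => cut_at s (answers g n)) (fun n => g (answers g n)).

Lemma follows_counterplay (s : White_strategy B) (g : seq bool -> bool) :
  follows s (counterplay s g).
Proof.
split=> // n; rewrite /= /cut_at; congr (Defs.next s _ _).
rewrite /history -/(mkseq _ n).
elim: n => //= n IHn.
by rewrite mkseqS -IHn /position foldl_rcons.
Qed.

(** Distributivity is stated for countably many alternatives, so the family of
    all the cuts in the tree of positions is enumerated by [pickle].  Both sides
    of a cut are taken below the opening, so that they partition it without any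
    appeal to the legality of the cut, which is known along plays only. *)
Lemma White_wins_G1_nondistributive :
  White_has_winning_strategy (@G1_White_wins d B) -> ~ omega2_distributive B.
Proof.
move=> [s win_s] /omega2_distributiveP distr; pose p := opening s.
have p_gt0 : \bot < p.
  by have [[]] := win_s _ (follows_counterplay s (fun=> true)).
pose b n j := let a := cut_at s (odflt [::] (unpickle n)) in
  if j then p `\` a else p `&` a.
have [n|f [q [/andP[q_gt0 _] le_qb]]] := distr b p p_gt0.
  by rewrite /b joinIB.
pose g phi := f (pickle (phi : seq bool)).
have [_ win] := win_s _ (follows_counterplay s g).
move: q_gt0; rewrite lt0x -lex0 -win => /negP; apply.
apply/le_biginf_range => n.
have := le_qb (pickle (answers g n)); rewrite /b pickleK /= /part /= -/(g _).
by case: (g _) => // /le_trans; apply; exact: leIr.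
Qed.

End CompleteBooleanAlgebra.

Theorem theorem5 (d : Order.disp_t) (B : ctbDistrLatticeType d)
    (B_complete : complete_boolean_algebra B) :
  (~ omega2_distributive B <-> White_has_winning_strategy (@G1_White_wins d B))
  /\
  (White_has_winning_strategy (@G1_White_wins d B) <->
   White_has_winning_strategy (@G2_White_wins d B)).
Proof.
have ac := nondistributive_White_wins_G2 B_complete.
have ba := White_wins_G1_nondistributive B_complete.
have cb : White_has_winning_strategy (@G2_White_wins d B) ->
    White_has_winning_strategy (@G1_White_wins d B).
  move=> [s win_s]; exists s => P /win_s[rules win2].
  by split=> //; exact: (G2_White_wins_G1 B_complete).
by split; [split=> [/ac/cb | /ba] | split=> [/ba/ac | /cb]].
Qed.
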